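(* Let $n>1$, let $U$ be the purely odd $(0|n)$-dimensional standard $\mathfrak{gl}(n)$-module, $\mathfrak{g}_{-1}=U$, $\mathfrak{g}_0=\mathfrak{gl}(n)$ and $\hat{\mathfrak{g}}_0=\mathfrak{sl}(n)$ (so that $\mathfrak{g}_*(\mathfrak{g}_{-1},\mathfrak{g}_0)=\mathfrak{vect}(0|n)$ and $\mathfrak{g}_*(\mathfrak{g}_{-1},\hat{\mathfrak{g}}_0)=\mathfrak{svect}(0|n)$; this is the case $m=1$ of the standard $\mathbb{Z}$-grading of $\mathfrak{sl}(m|n)$). Then a) $H^{k,2}_{\mathfrak{g}_0}=0$ for every $k>0$; b) $H^{k,2}_{\hat{\mathfrak{g}}_0}=\Pi^n(\mathbb{C})\,\delta_{kn}$, i.e. $H^{n,2}_{\hat{\mathfrak{g}}_0}$ is the trivial one-dimensional $\mathfrak{sl}(n)$-module of parity $n \bmod 2$ and $H^{k,2}_{\hat{\mathfrak{g}}_0}=0$ for $k\neq n$, $k>0$.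
   Context: Cartan prolongation of $(\mathfrak{g}_{-1},\mathfrak{g}_0)$: $\mathfrak{g}_i=(\mathfrak{g}_{i-1}\otimes\mathfrak{g}_{-1}^* )\cap(\mathfrak{g}_{i-2}\otimes S^2\mathfrak{g}_{-1}^* )$ for $i\ge1$ (super-symmetric powers), $\mathfrak{g}_*=\bigoplus_{i\ge-1}\mathfrak{g}_i$. Spencer complex: $C^{k,s}_{\mathfrak{g}_0}=\mathfrak{g}_{k-s}\otimes\Lambda^s(\mathfrak{g}_{-1}^* )$ (super-exterior power) with differential $(\partial f)(g_1,\dots,g_{s+1})=\sum_i(-1)^i[f(g_1,\dots,\widehat{g_{s+1-i}},\dots,g_{s+1}),g_{s+1-i}]$ (signs by the sign rule); $H^{k,s}_{\mathfrak{g}_0}$ is its cohomology in bidegree $(k,s)$, similarly for $\hat{\mathfrak{g}}_0$. $\mathfrak{vect}(0|n)$ is the derivation algebra of the Grassmann algebra on $n$ generators, $\mathfrak{svect}(0|n)$ its divergence-free part. $\Pi$ is the change of parity functor. *)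

(* Defs.v *)
From HB Require Import structures.
From mathcomp Require Import all_boot all_order all_algebra all_fingroup.
Set Implicit Arguments. Unset Strict Implicit. Unset Printing Implicit Defensive.
Import GRing.Theory Num.Theory.
Local Open Scope ring_scope.

Section Spencer.
Variable F : fieldType.
Variable n : nat.

(* Elements of U are row vectors 'rV[F]_n, e_a the standard basis.
   A multilinear map U^m -> U is determined (freely) by its values on basis
   tuples (e_{t_1},...,e_{t_m}); ML m is this coefficient representation.
   ML 0 = U = g_{-1}, ML 1 = Hom(U,U) = gl(n). *)
Definition ML (m : nat) := {ffun m.-tuple 'I_n -> 'rV[F]_n}.

(* [X, u] for X in g_{m}, u = e_a in g_{-1}: insert u as the last argument. *)
Definition contract m (X : ML m.+1) (a : 'I_n) : ML m :=
  [ffun t : m.-tuple 'I_n => X [tuple of rcons t a]].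

(* super-symmetry in the last two (odd) arguments = skew-symmetry *)
Definition skew2 m (X : ML m.+2) : bool :=
  [forall t : m.-tuple 'I_n, forall a : 'I_n, forall b : 'I_n,
     X [tuple of rcons (rcons t a) b] == - X [tuple of rcons (rcons t b) a]].

(* Cartan prolongation: prol g0 i = g_i, a subspace of ML i.+1.
   g_i = (g_{i-1} (x) g_{-1}^* ) /\ (g_{i-2} (x) S^2 g_{-1}^* ), g_{-1} = all of ML 0. *)
Fixpoint prol (g0 : pred (ML 1)) (i : nat) : pred (ML i.+1) :=
  match i as j return pred (ML j.+1) with
  | 0 => g0
  | i'.+1 => fun X =>
      [forall a : 'I_n, @prol g0 i' (contract X a)] && skew2 X &&
      (match i' as j return pred (ML j.+2) with
       | 0 => fun _ => true
       | i''.+1 => fun Y => [forall a : 'I_n, forall b : 'I_n,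
                               @prol g0 i'' (contract (contract Y b) a)]
       end) X
  end.

(* g_{a-1} as a subset of ML a (a = 0 : g_{-1} = U). *)
Definition gdeg (g0 : pred (ML 1)) (a : nat) : pred (ML a) :=
  match a as j return pred (ML j) with
  | 0 => fun _ => true
  | a'.+1 => @prol g0 a'
  end.

(* Cochains: s-linear maps on g_{-1} with values in ML a; C^{k,s} with
   k = a + s - 1 consists of those with values in g_{k-s} = g_{a-1} which are
   super-antisymmetric, i.e. (all arguments odd) symmetric. *)
Definition Cochain a s := {ffun s.-tuple 'I_n -> ML a}.

Definition in_C (g0 : pred (ML 1)) a s (c : Cochain a s) : Prop :=
  (forall t, @gdeg g0 a (c t)) /\
  (forall (t : s.-tuple 'I_n) (sg : 'S_s),
      c [tuple tnth t (sg i) | i < s] = c t).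

Definition del_tuple s (t : s.+1.-tuple 'I_n) (p : 'I_s.+1) : s.-tuple 'I_n :=
  [tuple tnth t (lift p i) | i < s].

(* Spencer differential C^{k,s} -> C^{k,s+1}:
   (d f)(g_1..g_{s+1}) = sum_i (-1)^i [f(..^g_{s+1-i}..), g_{s+1-i}] with the
   sign-rule sign (-1)^i from moving g_{s+1-i} past i odd elements, so all
   signs cancel. *)
Definition spencer_d a s (c : Cochain a.+1 s) : Cochain a s.+1 :=
  [ffun t => \sum_(p < s.+1) contract (c (del_tuple t p)) (tnth t p)].

(* For k = m+1 > 0: C^{k,1} = Cochain m.+1 1, C^{k,2} = Cochain m 2,
   C^{k,3} = Cochain m.-1 3 (zero space when m = 0, since g_{-2} = 0). *)
Definition cocycle2 m : Cochain m 2 -> Prop :=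
  match m as j return Cochain j 2 -> Prop with
  | 0 => fun _ => True
  | m'.+1 => fun c => spencer_d c = 0
  end.

Definition coboundary2 (g0 : pred (ML 1)) m (c : Cochain m 2) : Prop :=
  exists b : Cochain m.+1 1, in_C g0 b /\ c = spencer_d b.

Definition H2_vanishes (g0 : pred (ML 1)) m : Prop :=
  forall c : Cochain m 2, in_C g0 c -> cocycle2 c -> coboundary2 g0 c.

Definition gl_n : pred (ML 1) := fun _ => true.
Definition sl_n : pred (ML 1) :=
  fun X => \sum_(a < n) (X [tuple a]) 0 a == 0.

Definition actU (X : ML 1) (v : 'rV[F]_n) : 'rV[F]_n :=
  \sum_(b < n) v 0 b *: X [tuple b].
Definition replace m (t : m.-tuple 'I_n) (i : 'I_m) (b : 'I_n) : m.-tuple 'I_n :=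
  [tuple if j == i then b else tnth t j | j < m].
Definition actML m (X : ML 1) (Y : ML m) : ML m :=
  [ffun t => actU X (Y t) -
     \sum_(i < m) \sum_(b < n) (X [tuple tnth t i]) 0 b *: Y (replace t i b)].
Definition actC a s (X : ML 1) (c : Cochain a s) : Cochain a s :=
  [ffun t => actML X (c t) -
     \sum_(i < s) \sum_(b < n) (X [tuple tnth t i]) 0 b *: c (replace t i b)].

Definition H2_trivial_1dim (g0 : pred (ML 1)) m : Prop :=
  (exists c0 : Cochain m 2,
     [/\ in_C g0 c0, cocycle2 c0, ~ coboundary2 g0 c0 &
       forall z : Cochain m 2, in_C g0 z -> cocycle2 z ->
         exists l : F, coboundary2 g0 (z - l *: c0)]) /\
  (forall (X : ML 1) (z : Cochain m 2),
     g0 X -> in_C g0 z -> cocycle2 z -> coboundary2 g0 (actC X z)).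

End Spencer.

(* Parity (in Z/2, as 0/1) of the homogeneous space C^{k,s} = Cochain a s,
   whose elements are maps U^{(x)(a+s)} -> U with U purely odd:
   parity = (a + s) + 1 mod 2 by the sign rule. *)
Definition cochain_parity (a s : nat) : nat := (a + s).+1 %% 2.

(* Main.v *)
(* Up to signs the Spencer complex of gl(n) is the Koszul complex
   S(U^* ) (x) Lambda(U^* ) (x) U, which is exact in positive total degree: this
   is a). For sl(n) a cocycle [c] takes divergence-free values, and the
   divergence of its Koszul primitive is the partial trace of [c]. The cocycle
   condition makes that trace an alternating form [w] in m + 1 = k arguments.
   Since the divergence of [w /\ id] is (n - k) w, for k <> n the primitive can
   be corrected to a divergence-free one. For k = n there are no nonzero
   divergence-free cochains in C^{n,1}, hence no coboundaries; [w] then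
   determines [c] and is a multiple of the volume form, on which sl(n) acts
   trivially. *)
Require Import Defs.
From HB Require Import structures.
From mathcomp Require Import all_boot all_order all_algebra all_fingroup.
From mathcomp Require Import ring.
Set Implicit Arguments. Unset Strict Implicit. Unset Printing Implicit Defensive.
Import GRing.Theory Num.Theory.
Local Open Scope ring_scope.

(** * Alternating functions on sequences and signed sums *)

Definition alternating (T : Type) (V : zmodType) (f : seq T -> V) : Prop :=
  forall s1 a b s2, f (s1 ++ a :: b :: s2) = - f (s1 ++ b :: a :: s2).

(** The sum over positions i, with sign (-1)^i, of [f] at the i-th entry and the remaining sequence:
    in Grassmann variables, the operator sum_p theta_p f_p. *)
Fixpoint alt (T : Type) (V : zmodType) (f : T -> seq T -> V) (v : seq T) : V :=
  if v is a :: v' then f a v' - alt (fun p s => f p (a :: s)) v' else 0.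

Definition supp (T : Type) (V : zmodType) m (f : seq T -> V) : Prop :=
  forall s, size s != m -> f s = 0.

Section Alternation.
Variables (T : eqType) (V : zmodType).
Implicit Types (f : seq T -> V) (g : T -> seq T -> V).

Lemma alternating_cons f a : alternating f -> alternating (fun s => f (a :: s)).
Proof. by move=> fS s1 b c s2; rewrite -!cat_cons fS. Qed.

Lemma alternating_swap f a b s : alternating f -> f (a :: b :: s) = - f (b :: a :: s).
Proof. by move=> fS; rewrite (fS [::]). Qed.

Lemma alternating_rcons f s a :
  alternating f -> f (rcons s a) = if odd (size s) then - f (a :: s) else f (a :: s).
Proof.
elim: s f => [|x s IHs] f fS //=.
rewrite (IHs (fun s => f (x :: s))) /=; last exact: alternating_cons.
by rewrite [f (x :: a :: s)](alternating_swap _ _ _ fS) opprK; case: (odd _).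
Qed.

Lemma alternating_move f a s1 s2 :
  alternating f -> f (s1 ++ a :: s2) = 0 -> f (a :: s1 ++ s2) = 0.
Proof.
elim: s1 f => [|x s1 IHs] f fS //= f0.
rewrite alternating_swap //.
by rewrite (IHs (fun s => f (x :: s))) ?oppr0 //; exact: alternating_cons.
Qed.

(** Only vanishing is transported along a permutation, which saves tracking its sign. *)
Lemma alternating_perm f s t : alternating f -> perm_eq s t -> f t = 0 -> f s = 0.
Proof.
elim: s f t => [|a s IHs] f t fS.
  by rewrite perm_sym => /perm_nilP ->.
move=> st; have at_ : a \in t by rewrite -(perm_mem st) mem_head.
case/splitPr: t / at_ st => t1 t2 st f0.
apply: (IHs (fun s => f (a :: s)) (t1 ++ t2)); first exact: alternating_cons.
  by rewrite -(perm_cons a) (perm_trans st) // perm_catC /= perm_cons perm_catC.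
exact: alternating_move.
Qed.

Lemma eq_alt g1 g2 v : (forall p s, g1 p s = g2 p s) -> alt g1 v = alt g2 v.
Proof.
by elim: v g1 g2 => //= a v IHv g1 g2 eg; rewrite eg (IHv _ (fun p s => g2 p (a :: s))).
Qed.

Lemma alt_eq0 g v : (forall p s, p \in v -> g p s = 0) -> alt g v = 0.
Proof.
elim: v g => //= a v IHv g g0.
rewrite g0 ?mem_head // IHv ?subr0 // => p s pv.
by rewrite g0 // inE pv orbT.
Qed.

Lemma altD g1 g2 v : alt (fun p s => g1 p s + g2 p s) v = alt g1 v + alt g2 v.
Proof.
elim: v g1 g2 => [|a v IHv] g1 g2 /=; first by rewrite addr0.
by rewrite IHv opprD addrACA.
Qed.

Lemma altN g v : alt (fun p s => - g p s) v = - alt g v.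
Proof.
elim: v g => [|a v IHv] g /=; first by rewrite oppr0.
by rewrite IHv opprB opprK addrC.
Qed.

(** Exchanging two adjacent entries interchanges the two terms that extract one of them, and these
    have opposite signs; every other term changes sign because [g p] does. *)
Lemma alternating_alt g : (forall p, alternating (g p)) -> alternating (alt g).
Proof.
move=> gS s1 a b s2; elim: s1 g gS => [|x s1 IHs] g gS /=.
  rewrite (eq_alt (g2 := fun p s => - g p (b :: a :: s))).
    by rewrite altN !opprD !opprK addrCA.
  by move=> p s; rewrite alternating_swap.
rewrite gS IHs ?opprB ?opprK; first by rewrite addrC.
by move=> p; apply: alternating_cons.
Qed.

Lemma supp_alt m g : (forall p, supp m (g p)) -> supp m.+1 (alt g).
Proof.
move=> gm s; elim: s m g gm => //= a s IHs m g gm; rewrite eqSS => sm.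
rewrite gm // sub0r; case: m gm sm => [|m] gm sm.
  by rewrite alt_eq0 ?oppr0 // => p t _; rewrite gm.
by rewrite (IHs m) ?oppr0 // => p t tm; rewrite gm.
Qed.

(* Euler's identity for the operator [sum_p theta_p d/d theta_p]. *)
Lemma alt_cons f v : alternating f -> alt (fun p s => f (p :: s)) v = f v *+ size v.
Proof.
elim: v f => [|a v IHv] f fS //=.
rewrite (eq_alt (g2 := fun p s => - f (a :: p :: s))); last by move=> *; rewrite alternating_swap.
by rewrite altN opprK (IHv (fun s => f (a :: s))) ?mulrS //; exact: alternating_cons.
Qed.

End Alternation.

(** * The Koszul homotopy *)

Section Koszul.
Variables (T : eqType) (V : zmodType) (z : T -> T -> seq T -> V).
Hypothesis zS : forall x y, alternating (z x y).
Hypothesis zC : forall x y s, z x y s = z y x s.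
Hypothesis z_closed :
  forall x y w s, z x y (w :: s) + z x w (y :: s) + z y w (x :: s) = 0.

(** [alt] turns a symmetric argument of [z] into an alternating one. On a cocycle, going back by the
    opposite differential multiplies by the total degree: the two leading terms give 2, and
    closedness reduces the rest to Euler's identity, which gives [size u]. *)
Lemma koszul_homotopy x y u :
  alt (z x) (y :: u) + alt (z y) (x :: u) = z x y u *+ (size u).+2.
Proof.
rewrite /= (zC y x) addrACA -opprD -altD -mulr2n.
rewrite (eq_alt (g2 := fun p s => - z x y (p :: s))).
  by rewrite altN opprK alt_cons // -mulrnDr.
move=> p s; apply/eqP; rewrite -addr_eq0 addrC addrA; exact/eqP.
Qed.

End Koszul.

(** Once two equal entries are adjacent, f = -f, and characteristic zero gives f = 0. *)
Lemma alternating_dup (T : eqType) (R : numDomainType) (f : seq T -> R) s :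
  alternating f -> ~~ uniq s -> f s = 0.
Proof.
have dup2 (g : seq T -> R) a s1 s2 : alternating g -> g (a :: s1 ++ a :: s2) = 0.
  elim: s1 g => [|x s1 IHs] g gS /=.
    apply/eqP; have /eqP := gS [::] a a s2.
    by rewrite -addr_eq0 -mulr2n mulrn_eq0.
  rewrite alternating_swap // (IHs (fun s => g (x :: s))) ?oppr0 //; exact: alternating_cons.
elim: s f => //= a s IHs f fS; rewrite negb_and negbK => /orP [as_|us].
  by case/splitPr: s / as_ {IHs} => s1 s2; exact: dup2.
by rewrite (IHs (fun s => f (a :: s))) //; exact: alternating_cons.
Qed.

(** * Divergence, top-degree forms and the action of gl(n) on them *)

Section Trace.
Variables (F : numFieldType) (n : nat).
Notation I := 'I_n.
Implicit Types (f : seq I -> 'rV[F]_n) (w : seq I -> F).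

Definition dvg f (s : seq I) : F := \sum_(c < n) f (c :: s) 0 c.

(** The traced argument is either the entry that [alt] extracts, which gives the first sum, or it
    stays in front of the rest, which costs a sign. *)
Lemma dvg_alt (g : I -> seq I -> 'rV[F]_n) u :
  dvg (alt g) u = \sum_(c < n) g c u 0 c - alt (fun p => dvg (g p)) u.
Proof.
rewrite /dvg /= (eq_bigr (fun c => g c u 0 c - alt (fun p s => g p (c :: s)) u 0 c)).
  rewrite sumrB; congr (_ - _).
  (* Separating the traced index from the sequence makes the induction on [u] possible. *)
  suff E (k : I -> I -> seq I -> 'rV[F]_n) :
      \sum_(c < n) alt (k c) u 0 c = alt (fun p s => \sum_(c < n) k c p s 0 c) u.
    exact: E (fun c p s => g p (c :: s)).
  elim: u k => [|a u IHu] k /=; first by rewrite big1 // => c _; rewrite mxE.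
  rewrite -(IHu (fun c p s => k c p (a :: s))) -sumrB.
  by apply: eq_bigr => c _; rewrite !mxE.
by move=> c _; rewrite !mxE.
Qed.

Lemma alternating_coord f c : alternating f -> alternating (fun s => f s 0 c).
Proof. by move=> fS s1 a b s2; rewrite fS mxE. Qed.

(** The Euler vector field multiplied by the Grassmann polynomial [w]. *)
Definition wedge_id w : seq I -> 'rV[F]_n :=
  alt (fun p s => w s *: delta_mx 0 p).

Lemma alternating_wedge_id w : alternating w -> alternating (wedge_id w).
Proof. by move=> wS; apply: alternating_alt => p s1 a b s2; rewrite wS scaleNr. Qed.

(** The trace of the identity contributes n, and Euler's identity contributes [size v] with the
    opposite sign. *)
Lemma dvg_wedge_id w v : alternating w -> dvg (wedge_id w) v = w v * (n%:R - (size v)%:R).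
Proof.
move=> wS; rewrite /wedge_id dvg_alt.
rewrite (eq_bigr (fun=> w v)); last by move=> c _; rewrite !mxE !eqxx mulr1.
rewrite sumr_const card_ord (eq_alt (g2 := fun p s => w (p :: s))).
  by rewrite alt_cons // mulrBr !mulr_natr.
move=> p s; rewrite /dvg (bigD1 p) //= big1 ?addr0 => [|c cp].
  by rewrite !mxE !eqxx mulr1.
by rewrite !mxE (negPf cp) andbF mulr0.
Qed.

Lemma uniq_full (v : seq I) x : size v = n -> uniq v -> x \in v.
Proof.
move=> vn uv; have [|_ ->] := uniq_min_size uv (fun y _ => mem_enum I y).
  by rewrite size_enum_ord vn.
by rewrite mem_enum.
Qed.

(** Forms of top degree span at most a line, stated as vanishing: one repetition-free sequence
    decides all values. *)
Lemma alternating_uniq_perm w s t : size s = n -> size t = n -> uniq t ->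
  alternating w -> w t = 0 -> w s = 0.
Proof.
move=> sn tn ut wS wt; have [us|] := boolP (uniq s); last exact: alternating_dup.
apply: (alternating_perm wS) wt; apply: uniq_perm => // x.
by rewrite !uniq_full.
Qed.

(** Divergence is injective in top degree. With the entry [c] moved to the front, the divergence at
    the other entries reduces to the coordinate [c] of [f v], since any other index repeats an
    entry. *)
Lemma alternating_dvg0_top f v :
  alternating f -> (forall s, dvg f s = 0) -> size v = n -> f v = 0.
Proof.
move=> fS f0 vn; apply/rowP => c; rewrite mxE.
have gS d := alternating_coord d fS.
have [uv|] := boolP (uniq v); last exact: alternating_dup (gS c).
have cv := uniq_full c vn uv.
case/splitPr: v / cv vn uv => s1 s2 vn uv.
have pv : perm_eq (s1 ++ c :: s2) (c :: s1 ++ s2) by rewrite -[_ :: s2]cat1s perm_catCA.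
apply: (alternating_perm (gS c) pv).
rewrite -[RHS](f0 (s1 ++ s2)) /dvg (bigD1 c) //= big1 ?addr0 // => d dc.
apply: (alternating_dup (gS d)); rewrite /= negb_and negbK.
have: d \in s1 ++ c :: s2 by exact: uniq_full.
by rewrite (perm_mem pv) inE (negPf dc) /= => ->.
Qed.

(** The wedge product of the coordinate forms listed in [l], by Laplace expansion of the
    determinant. *)
Fixpoint vol (l v : seq I) : F :=
  if l is k :: l' then alt (fun p s => (p == k)%:R * vol l' s) v
  else (v == [::])%:R.

Lemma alternating_vol l : alternating (vol l).
Proof.
elim: l => [|k l IHl] /=; first by move=> [|? ?] a b s2; rewrite oppr0.
by apply: alternating_alt => p s1 a b s2; rewrite IHl mulrN.
Qed.

Lemma supp_vol l : supp (size l) (vol l).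
Proof.
elim: l => [|k l IHl] /=; first by move=> s; rewrite size_eq0 => /negPf ->.
by apply: supp_alt => p s sl; rewrite IHl ?mulr0.
Qed.

Lemma vol_id l : uniq l -> vol l l = 1.
Proof.
elim: l => //= k l IHl /andP[kl ul].
rewrite eqxx mul1r IHl // alt_eq0 ?subr0 // => p s pl.
by case: eqP kl pl => [->|_ _ _]; [move=> /negPf -> | rewrite mul0r].
Qed.

(** The Leibniz sum of substitutions of [X] into each argument, that is, minus the contragredient
    action on forms. *)
Fixpoint leib (X : I -> I -> F) w (v : seq I) : F :=
  if v is a :: v' then
    \sum_(b < n) X a b * w (b :: v') + leib X (fun s => w (a :: s)) v'
  else 0.

Lemma eq_leib X w1 w2 v : w1 =1 w2 -> leib X w1 v = leib X w2 v.
Proof.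
elim: v w1 w2 => //= a v IHv w1 w2 ew; congr (_ + _).
  by apply: eq_bigr => b _; rewrite ew.
by apply: IHv => s; rewrite ew.
Qed.

Lemma leibN X w v : leib X (fun s => - w s) v = - leib X w v.
Proof.
elim: v w => [|a v IHv] w /=; first by rewrite oppr0.
by rewrite IHv opprD -sumrN; congr (_ + _); apply: eq_bigr => b _; rewrite mulrN.
Qed.

Lemma alternating_leib X w : alternating w -> alternating (leib X w).
Proof.
move=> wS s1 a b s2; elim: s1 w wS => [|x s1 IHs] w wS /=.
  rewrite (@eq_leib _ _ (fun s => - w (b :: a :: s))) => [|s]; last exact: alternating_swap.
  rewrite leibN !addrA !opprD; congr (_ - _); rewrite addrC.
  by congr (_ + _); rewrite -sumrN; apply: eq_bigr => c _; rewrite alternating_swap // mulrN.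
rewrite IHs ?opprD -?sumrN; last exact: alternating_cons.
congr (_ + _); apply: eq_bigr => c _.
by rewrite -!cat_cons wS mulrN.
Qed.

(** Replacing an entry by a different index repeats an entry, so only the diagonal of [X] survives.
    The prefix [s1] serves the induction. *)
Lemma leib_uniq X w s1 s2 : alternating w -> size (s1 ++ s2) = n -> uniq (s1 ++ s2) ->
  leib X (fun s => w (s1 ++ s)) s2 = (\sum_(a <- s2) X a a) * w (s1 ++ s2).
Proof.
move=> wS; elim: s2 s1 => [|a s2 IHs] s1 /=; first by rewrite big_nil mul0r.
move=> sn us; rewrite big_cons mulrDl; congr (_ + _).
  rewrite (bigD1 a) //= big1 ?addr0 // => b ba.
  rewrite (alternating_dup wS) ?mulr0 //.
  have pp c : perm_eq (s1 ++ c :: s2) (c :: s1 ++ s2) by rewrite -[_ :: s2]cat1s perm_catCA.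
  have := uniq_full b sn us.
  by rewrite (perm_mem (pp a)) (perm_uniq (pp b)) inE (negPf ba) /= => ->.
rewrite (@eq_leib _ _ (fun s => w ((rcons s1 a) ++ s))) => [|s]; last by rewrite cat_rcons.
by rewrite IHs cat_rcons.
Qed.

Lemma leib_top X w v : alternating w -> size v = n -> \sum_(a < n) X a a = 0 ->
  leib X w v = 0.
Proof.
move=> wS vn X0; have [uv|] := boolP (uniq v).
  rewrite (@leib_uniq X w [::]) //= big_uniq //=.
  rewrite (eq_bigl predT) ?X0 ?mul0r // => a; exact: uniq_full.
by apply: alternating_dup; apply: alternating_leib.
Qed.

End Trace.

(** * The Cartan prolongs as alternating functions on sequences *)

Section Evaluation.
Variables (F : numFieldType) (n : nat).
Notation I := 'I_n.
Notation ML := (ML F n).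

(* Extension by zero to sequences of the wrong length; it turns the
   tuple-indexed coefficients into functions on [seq 'I_n], where arguments can
   be moved without casts. *)
Definition ev m (X : ML m) (s : seq I) : 'rV[F]_n := oapp X 0 (insub s).

Lemma ev_tuple m (X : ML m) (t : m.-tuple I) : ev X t = X t.
Proof. by rewrite /ev valK. Qed.

Lemma supp_ev m (X : ML m) : supp m (ev X).
Proof. by move=> s sm; rewrite /ev insubN. Qed.

Lemma tuple_or_size m (P : seq I -> Prop) :
  (forall t : m.-tuple I, P t) -> (forall s, size s != m -> P s) -> forall s, P s.
Proof.
move=> Pt P0 s; have [sm|] := eqVneq (size s) m; last exact: P0.
by move/eqP: sm => sm; exact: (Pt (Tuple sm)).
Qed.

Lemma ev_inj m (X Y : ML m) : ev X =1 ev Y -> X = Y.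
Proof. by move=> eXY; apply/ffunP => t; rewrite -!ev_tuple eXY. Qed.

Lemma ev_ffun m (f : seq I -> 'rV[F]_n) :
  supp m f -> ev [ffun t : m.-tuple I => f t] =1 f.
Proof.
move=> fm; apply: (tuple_or_size (m := m)) => [t|s sm].
  by rewrite ev_tuple ffunE.
by rewrite fm // supp_ev.
Qed.

Lemma ev_contract m (X : ML m.+1) a s : ev (contract X a) s = ev X (rcons s a).
Proof.
move: s; apply: (tuple_or_size (m := m)) => [t|s sm].
  by rewrite ev_tuple ffunE -ev_tuple.
by rewrite !supp_ev // size_rcons eqSS.
Qed.

Lemma evD m (X Y : ML m) s : ev (X + Y) s = ev X s + ev Y s.
Proof. by rewrite /ev; case: insub => [t|] /=; rewrite ?ffunE ?addr0. Qed.

Lemma evZ m l (X : ML m) s : ev (l *: X) s = l *: ev X s.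
Proof. by rewrite /ev; case: insub => [t|] /=; rewrite ?ffunE ?scaler0. Qed.

Lemma ev0 m s : ev (0 : ML m) s = 0.
Proof. by rewrite /ev; case: insub => [t|] /=; rewrite ?ffunE. Qed.

(** An adjacent transposition either moves the last two arguments or leaves the last one alone, and
    is then seen by a contraction. *)
Lemma alternating_evSS m (X : ML m.+2) :
  alternating (ev X) <-> skew2 X /\ forall c, alternating (ev (contract X c)).
Proof.
split=> [XS | [/forallP X2 XS]].
  split=> [|c s1 a b s2]; last by rewrite !ev_contract !rcons_cat /= XS.
  apply/forallP => t; apply/forallP => a; apply/forallP => b.
  by rewrite -!ev_tuple /= -!cats1 -!catA /= XS.
move=> s1 a b s2; case/lastP: s2 => [|s2 c].
  rewrite -!(cat_rcons _ _ [:: _]) !cats1.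
  move: s1; apply: (tuple_or_size (m := m)) => [t|s sm].
    by move/forallP/(_ a)/forallP/(_ b)/eqP: (X2 t); rewrite -!ev_tuple.
  by rewrite !supp_ev ?oppr0 // !size_rcons !eqSS.
by rewrite -!rcons_cons -!rcons_cat -!ev_contract XS.
Qed.

Lemma gdegSS (g0 : pred (ML 1)) m (X : ML m.+2) :
  gdeg g0 X = [forall a, gdeg g0 (contract X a)] && skew2 X &&
              [forall a, forall b, gdeg g0 (contract (contract X b) a)].
Proof.
case: m X => [|m] X //=; congr (_ && _); apply/esym.
by apply/forallP => a; apply/forallP.
Qed.

(** Treats both algebras at once: [Q] is a condition inherited through contractions, trivial for
    gl(n) and zero divergence for sl(n). The induction is strong because the prolongation looks two
    degrees back. *)
Lemma gdegE (g0 : pred (ML 1)) (Q : forall m, ML m -> Prop) :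
  (forall X : ML 0, Q 0 X) -> (forall X : ML 1, g0 X <-> Q 1 X) ->
  (forall m (X : ML m.+2), Q m.+2 X <-> forall c, Q m.+1 (contract X c)) ->
  forall m (X : ML m), gdeg g0 X <-> alternating (ev X) /\ Q m X.
Proof.
move=> Q0 Q1 QSS; elim/ltn_ind => [[|[|m]]] IHm X.
- split=> // _; split=> // s1 a b s2.
  by rewrite !supp_ev ?oppr0 // !size_cat /= !addnS.
- split=> [/Q1 X1|[_ /Q1]//]; split=> // s1 a b s2.
  by rewrite !supp_ev ?oppr0 // !size_cat /= !addnS.
rewrite gdegSS alternating_evSS QSS; split.
  case/andP=> /andP[/forallP Xc X2] _; split; first split=> // c.
    by case/IHm: (Xc c).
  by move=> c; case/IHm: (Xc c).
case=> [[X2 Xs] XQ]; have Xc c : gdeg g0 (contract X c) by apply/IHm.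
rewrite X2 andbT; apply/andP; split; first exact/forallP.
apply/forallP => a; apply/forallP => b; apply/IHm => //.
split; last by case: m {IHm Xs Xc X2} X XQ => // m X XQ; move/QSS: (XQ b).
move=> s1 c d s2; by rewrite !(ev_contract (contract _ _)) !rcons_cat /= Xs.
Qed.

Lemma gdeg_glE m (X : ML m) : gdeg (@gl_n F n) X <-> alternating (ev X).
Proof.
rewrite (gdegE (Q := fun _ _ => True)) //.
by split=> [[]|].
Qed.

(** The divergence traces the first argument while prolongation contracts the last, so the two do
    not interfere. *)
Lemma gdeg_slE m (X : ML m) :
  gdeg (@sl_n F n) X <-> alternating (ev X) /\ forall s, dvg (ev X) s = 0.
Proof.
have dvg_size k (Y : ML k) s : (size s).+1 != k -> dvg (ev Y) s = 0.
  by move=> sk; rewrite /dvg big1 // => c _; rewrite supp_ev ?mxE.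
apply: (gdegE (Q := fun m X => forall s, dvg (ev X) s = 0)) => [Y s|Y|k Y].
- exact: dvg_size.
- have dvgE : dvg (ev Y) [::] = \sum_(a < n) Y [tuple a] 0 a.
    by apply: eq_bigr => c _; rewrite -ev_tuple.
  rewrite /sl_n -dvgE; split=> [/eqP Y0 [|a s]|->] //.
  exact: dvg_size.
- split=> [Y0 c s|Y0 s].
    by rewrite -[RHS](Y0 (rcons s c)); apply: eq_bigr => d _; rewrite ev_contract.
  case/lastP: s => [|s c]; first exact: dvg_size.
  by rewrite -[RHS](Y0 c s); apply: eq_bigr => d _; rewrite ev_contract.
Qed.

End Evaluation.

(** * Cocycles, primitives and the vanishing results *)

Section LowDegreeCochains.
Variables (F : numFieldType) (n : nat).
Notation I := 'I_n.
Notation ML := (ML F n).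
Notation Cochain := (Cochain F n).

Lemma tuple1_eta (t : 1.-tuple I) : t = [tuple tnth t ord0].
Proof. by apply: eq_from_tnth => i; rewrite (ord1 i). Qed.

Lemma tuple2_eta (t : 2.-tuple I) : t = [tuple tnth t ord0; tnth t ord_max].
Proof.
by apply/val_inj; case: t => [[|x [|y [|]]]] // i; rewrite /= !(tnth_nth x).
Qed.

Lemma in_C1E (g0 : pred (ML 1)) a (b : Cochain a 1) :
  in_C g0 b <-> forall x, gdeg g0 (b [tuple x]).
Proof.
split=> [[bg _] x // | bg]; split=> [t | t sg]; first by rewrite (tuple1_eta t).
by congr (b _); apply: eq_from_tnth => i; rewrite tnth_mktuple !(ord1 (_ : 'I_1)).
Qed.

Lemma in_C2E (g0 : pred (ML 1)) a (c : Cochain a 2) :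
  in_C g0 c <-> (forall x y, gdeg g0 (c [tuple x; y])) /\
                (forall x y, c [tuple x; y] = c [tuple y; x]).
Proof.
split=> [[cg cS]|[cg cS]].
  split=> // x y; rewrite -(cS _ (tperm ord0 ord_max)); congr (c _).
  by rewrite [LHS]tuple2_eta !tnth_mktuple tpermL tpermR.
split=> [t|t sg]; first by rewrite (tuple2_eta t).
rewrite [in RHS](tuple2_eta t) (tuple2_eta [tuple _ | i < 2]) !tnth_mktuple.
have: sg ord0 != sg ord_max by rewrite (inj_eq perm_inj).
have ord2 (i : 'I_2) : i = ord0 \/ i = ord_max.
  by case: i => [[|[|//]]] i2; [left|right]; exact: val_inj.
by case: (ord2 (sg ord0)) (ord2 (sg ord_max)) => -> [] ->.
Qed.

Lemma spencer_d1E a (b : Cochain a.+1 1) x y :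
  spencer_d b [tuple x; y] = contract (b [tuple y]) x + contract (b [tuple x]) y.
Proof.
rewrite ffunE big_ord_recl big_ord1; congr (contract (b _) _ + contract (b _) _).
all: by rewrite (tuple1_eta (del_tuple _ _)) tnth_mktuple.
Qed.

Lemma spencer_d2E a (c : Cochain a.+1 2) x y w :
  spencer_d c [tuple x; y; w] = contract (c [tuple y; w]) x
    + (contract (c [tuple x; w]) y + contract (c [tuple x; y]) w).
Proof.
rewrite ffunE !big_ord_recl big_ord0 addr0.
congr (contract (c _) _ + (contract (c _) _ + contract (c _) _)).
all: by rewrite (tuple2_eta (del_tuple _ _)) !tnth_mktuple.
Qed.

Lemma tuple3_eta (t : 3.-tuple I) : exists x y w, t = [tuple x; y; w].
Proof.
case: t => [[|x [|y [|w [|]]]]] // i; exists x, y, w; exact: val_inj.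
Qed.

(** Contraction appends its argument; moving it to the front costs the same sign in all three terms.
    For m = 0 the equation holds because degree-0 values vanish on nonempty sequences. *)
Lemma cocycle2E m (c : Cochain m 2) :
  (forall x y, alternating (ev (c [tuple x; y]))) ->
  cocycle2 c <-> forall x y w s, ev (c [tuple x; y]) (w :: s)
     + ev (c [tuple x; w]) (y :: s) + ev (c [tuple y; w]) (x :: s) = 0.
Proof.
move=> cA; case: m c cA => [|m] c cA /=.
  by split=> // _ x y w s; rewrite !supp_ev // !addr0.
have dE x y w s : ev (spencer_d c [tuple x; y; w]) s =
    (if odd (size s) then -1 else 1) *: (ev (c [tuple x; y]) (w :: s)
     + ev (c [tuple x; w]) (y :: s) + ev (c [tuple y; w]) (x :: s)).
  rewrite spencer_d2E !evD !ev_contract !alternating_rcons //.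
  by case: ifP => _; rewrite ?scale1r ?scaleN1r ?opprD [RHS]addrC [X in _ = _ + X]addrC.
split=> [c0 x y w s|c0].
  have := dE x y w s; rewrite c0 ffunE ev0 => /esym/eqP.
  by case: ifP => _; rewrite ?scale1r ?scaleN1r ?oppr_eq0 => /eqP.
apply/ffunP => t; have [x [y [w ->]]] := tuple3_eta t.
by apply: ev_inj => s; rewrite dE c0 scaler0 ffunE ev0.
Qed.

(** The factor (-1)^m offsets moving the contracted argument from the end to the front past m
    others. *)
Lemma coboundary2_primitive (g0 : pred (ML 1)) m (c : Cochain m 2)
    (B : I -> seq I -> 'rV[F]_n) :
  (forall x (X : ML m.+1), ev X =1 (fun s => (-1) ^+ m *: B x s) -> gdeg g0 X) ->
  (forall x, supp m.+1 (B x)) -> (forall x, alternating (B x)) ->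
  (forall x y s, B x (y :: s) + B y (x :: s) = ev (c [tuple x; y]) s) ->
  coboundary2 g0 c.
Proof.
move=> Bg Bm BA cE.
pose b : Cochain m.+1 1 :=
  [ffun t => [ffun s : m.+1.-tuple I => (-1) ^+ m *: B (tnth t ord0) s]].
have bE x : ev (b [tuple x]) =1 (fun s => (-1) ^+ m *: B x s).
  rewrite ffunE; apply: ev_ffun => s sm; by rewrite Bm ?scaler0.
exists b; split; first by apply/in_C1E => x; exact: (Bg x).
apply/ffunP => t; rewrite (tuple2_eta t); move: (tnth _ _) (tnth _ _) => x y.
apply: ev_inj => s; rewrite spencer_d1E evD !ev_contract !bE -cE.
have [sm|sm] := eqVneq (size s) m; last first.
  by rewrite !Bm ?scaler0 ?size_rcons //= ?eqSS.
rewrite !alternating_rcons // sm -signr_odd addrC.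
by case: (odd m); rewrite ?expr1 ?expr0 ?scaleN1r ?opprK ?scale1r.
Qed.

Lemma gl_H2_vanishes m : H2_vanishes (@gl_n F n) m.
Proof.
move=> c /in_C2E[cg cS] cc.
have cA x y : alternating (ev (c [tuple x; y])) by apply/gdeg_glE.
have {cc}cc := (cocycle2E cA).1 cc.
(* Here m + 2 is the total degree produced by [koszul_homotopy]. *)
pose B x s := (m.+2%:R)^-1 *: alt (fun y => ev (c [tuple x; y])) s.
have BA x : alternating (B x).
  by move=> s1 a b s2; rewrite /B -scalerN (alternating_alt (cA x)).
apply: (@coboundary2_primitive _ _ _ B) => // [x X XE|x s sm|x y s].
- by apply/gdeg_glE => s1 a b s2; rewrite !XE BA scalerN.
- by rewrite /B (supp_alt _ sm) ?scaler0 // => p; exact: supp_ev.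
rewrite -scalerDr (@koszul_homotopy _ _ (fun x y => ev (c [tuple x; y]))) //; last first.
  by move=> *; rewrite cS.
have [->|sm] := eqVneq (size s) m; last by rewrite supp_ev // mul0rn scaler0.
by rewrite -scaler_nat scalerA mulVf ?scale1r // pnatr_eq0.
Qed.

Definition partial_trace m (c : Cochain m 2) x (u : seq I) : F :=
  \sum_(i < n) ev (c [tuple x; i]) u 0 i.

(* [partial_trace c], alternating in all its [m.+1] arguments for a cocycle [c],
   as a function of one sequence. *)
Definition trace_form m (c : Cochain m 2) (v : seq I) : F :=
  if v is x :: u then partial_trace c x u else 0.

(** For the first two arguments, set the third index of the cocycle identity to [i] and sum the
    coordinates [i]: one term is a divergence and vanishes, the other two are the traces to
    compare. *)
Lemma alternating_trace_form m (c : Cochain m 2) :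
  in_C (@sl_n F n) c -> cocycle2 c -> alternating (trace_form c).
Proof.
move=> /in_C2E[cg cS] cc.
have cA x y : alternating (ev (c [tuple x; y])) by case/gdeg_slE: (cg x y).
have c0 x y s : dvg (ev (c [tuple x; y])) s = 0 by case/gdeg_slE: (cg x y).
have {cc}cc := (cocycle2E cA).1 cc.
case=> [|x s1] a b s2 /=; last first.
  by rewrite /partial_trace -sumrN; apply: eq_bigr => i _; rewrite cA mxE.
apply/eqP; rewrite -addr_eq0 -[X in X == _]addr0 -[X in _ + X](c0 a b s2).
rewrite -!big_split big1 //= => i _.
have /(congr1 (fun r : 'rV_n => r 0 i)) := cc a b i s2.
by rewrite !mxE -addrA addrC.
Qed.

(** The second alternative serves k = n, after a multiple of [top_cocycle] has been subtracted. *)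
Lemma sl_coboundary m (c : Cochain m 2) :
  in_C (@sl_n F n) c -> cocycle2 c ->
  m.+1 <> n \/ (forall v, trace_form c v = 0) -> coboundary2 (@sl_n F n) c.
Proof.
move=> cC cc cT; have tA := alternating_trace_form cC cc.
case/in_C2E: cC => cg cS.
have cA x y : alternating (ev (c [tuple x; y])) by case/gdeg_slE: (cg x y).
have c0 x y s : dvg (ev (c [tuple x; y])) s = 0 by case/gdeg_slE: (cg x y).
have {cc}cc := (cocycle2E cA).1 cc.
(* This is 1/(n - k) for k = m + 1. At k = n the inverse of zero is zero, and there the trace form
   vanishes by assumption. *)
pose e := (n%:R - m.+1%:R : F)^-1.
pose W := wedge_id (trace_form c).
have WA : alternating W by exact: alternating_wedge_id.
pose B x s := (m.+2%:R)^-1 *: (alt (fun y => ev (c [tuple x; y])) s + e *: W (x :: s)).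
have BA x : alternating (B x).
  move=> s1 a b s2.
  by rewrite /B (alternating_alt (cA x)) (alternating_cons x WA) scalerN -opprD scalerN.
have Bm x : supp m.+1 (B x).
  have tm : supp m.+1 (trace_form c).
    case=> [|y s] //=; rewrite eqSS => sm.
    by rewrite /partial_trace big1 // => i _; rewrite supp_ev ?mxE.
  have Wm : supp m.+2 W by apply: supp_alt => p s sm; rewrite tm ?scale0r.
  move=> s sm; rewrite /B Wm ?eqSS // (supp_alt _ sm) => [|p]; last exact: supp_ev.
  by rewrite scaler0 addr0 scaler0.
have B0 x u : dvg (B x) u = 0.
  have [um|um] := eqVneq (size u) m; last first.
    by rewrite /dvg big1 // => i _; rewrite Bm ?mxE.
  transitivity ((m.+2%:R)^-1 * (dvg (alt (fun y => ev (c [tuple x; y]))) u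
      - e * dvg W (x :: u))).
    rewrite /dvg mulr_sumr -sumrB mulr_sumr; apply: eq_bigr => i _.
    by rewrite /B (alternating_swap x i _ WA) !mxE mulrN.
  rewrite dvg_alt alt_eq0 ?subr0 // dvg_wedge_id // /= um.
  apply/eqP; rewrite mulf_eq0 subr_eq0; apply/orP; right.
  rewrite -/(partial_trace c x u).
  case: cT => [mn|t0]; last by have /= -> := t0 (x :: u); rewrite mul0r mulr0.
  rewrite mulrCA mulVf ?mulr1 // subr_eq0 eqr_nat eq_sym; exact/eqP.
apply: (@coboundary2_primitive _ _ _ B) => // [x X XE|x y s].
  apply/gdeg_slE; split=> [s1 a b s2|s]; first by rewrite !XE BA scalerN.
  rewrite -[RHS](mulr0 ((-1) ^+ m)) -(B0 x s) mulr_sumr.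
  by apply: eq_bigr => i _; rewrite XE mxE.
(* [W] is alternating in [x] and [y], so the correction drops out of the coboundary. *)
rewrite -scalerDr addrACA -scalerDr (alternating_swap x y _ WA) addNr scaler0 addr0.
rewrite (@koszul_homotopy _ _ (fun x y => ev (c [tuple x; y]))) //; last first.
  by move=> *; rewrite cS.
have [->|sm] := eqVneq (size s) m; last by rewrite supp_ev // mul0rn scaler0.
by rewrite -scaler_nat scalerA mulVf ?scale1r // pnatr_eq0.
Qed.

End LowDegreeCochains.

(** * The class in degree k = n *)

Section TopDegree.
Variables (F : numFieldType) (m : nat).
Notation n := m.+1.
Notation I := 'I_n.
Notation ML := (ML F n).
Notation Cochain := (Cochain F n).

Lemma gdeg_sl_top (X : ML n) : gdeg (@sl_n F n) X -> X = 0.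
Proof.
case/gdeg_slE => XA X0; apply/ffunP => t.
by rewrite -ev_tuple (alternating_dvg0_top XA X0) ?size_tuple ?ffunE.
Qed.

Lemma sl_coboundary_top (c : Cochain m 2) : coboundary2 (@sl_n F n) c -> c = 0.
Proof.
case=> b [/in_C1E bC ->]; have {bC} bC x := gdeg_sl_top (bC x).
apply/ffunP => t; rewrite (tuple2_eta t) spencer_d1E !bC.
by apply: ev_inj => s; rewrite evD !ev_contract [in RHS]ffunE !ev0 addr0.
Qed.

Lemma in_C_sl_sub l (c d : Cochain m 2) :
  in_C (@sl_n F n) c -> in_C (@sl_n F n) d -> in_C (@sl_n F n) (c - l *: d).
Proof.
have E x y : (c - l *: d) [tuple x; y] = c [tuple x; y] + (- l) *: d [tuple x; y].
  by rewrite !ffunE scaleNr.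
move=> /in_C2E[cg cS] /in_C2E[dg dS]; apply/in_C2E; split=> x y; last first.
  by rewrite !E cS dS.
case/gdeg_slE: (cg x y) (dg x y) => cA c0 /gdeg_slE[dA d0].
apply/gdeg_slE; split=> [s1 a b s2|s].
  by rewrite E !evD !evZ cA dA scalerN opprD.
transitivity (dvg (ev (c [tuple x; y])) s - l * dvg (ev (d [tuple x; y])) s).
  rewrite /dvg mulr_sumr -sumrB; apply: eq_bigr => i _.
  by rewrite E evD evZ !mxE mulNr.
by rewrite c0 d0 mulr0 subr0.
Qed.

Lemma cocycle2_sub l (c d : Cochain m 2) :
  cocycle2 c -> cocycle2 d -> cocycle2 (c - l *: d).
Proof.
case: m c d => //= k c d c0 d0.
suff -> : spencer_d (c - l *: d) = spencer_d c - l *: spencer_d d.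
  by rewrite c0 d0 scaler0 subr0.
apply/ffunP => t; rewrite !ffunE scaler_sumr -sumrB; apply: eq_bigr => p _.
by apply/ffunP => u; rewrite !ffunE.
Qed.

Notation V := (vol F (enum I)).
Notation e x := (delta_mx 0 x : 'rV[F]_n).

(** The symmetrisation in x, y of the volume form contracted with e_x, tensored with e_y. *)
Definition top_cocycle : Cochain m 2 :=
  [ffun t => [ffun u : m.-tuple I =>
    V (tnth t ord0 :: u) *: e (tnth t ord_max)
    + V (tnth t ord_max :: u) *: e (tnth t ord0)]].

Let VA : alternating V := alternating_vol F (enum I).

Lemma supp_vol_top : supp n V.
Proof. by have := @supp_vol F n (enum I); rewrite size_enum_ord. Qed.

Lemma ev_top_cocycle x y u :
  ev (top_cocycle [tuple x; y]) u = V (x :: u) *: e y + V (y :: u) *: e x.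
Proof.
rewrite ffunE (ev_ffun (f := fun u => V (x :: u) *: e y + V (y :: u) *: e x)) //.
move=> {}u um.
by rewrite !supp_vol_top ?scale0r ?addr0.
Qed.

Lemma sum_delta (f : I -> F) a : \sum_i f i * (i == a)%:R = f a.
Proof.
rewrite (bigD1 a) //= eqxx mulr1 big1 ?addr0 // => i /negPf ->.
by rewrite mulr0.
Qed.

Lemma in_C_top_cocycle : in_C (@sl_n F n) top_cocycle.
Proof.
apply/in_C2E; split=> x y; last by apply: ev_inj => s; rewrite !ev_top_cocycle addrC.
apply/gdeg_slE; split=> [s1 a b s2|s].
  rewrite !ev_top_cocycle (alternating_cons x VA) (alternating_cons y VA).
  by rewrite !scaleNr opprD.
transitivity (V (x :: y :: s) + V (y :: x :: s)); last first.
  by rewrite alternating_swap // addNr.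
rewrite /dvg (eq_bigr (fun i => V (x :: i :: s) * (i == y)%:R + V (y :: i :: s) * (i == x)%:R)).
  rewrite big_split /= (sum_delta (fun i => V (x :: i :: s))).
  by rewrite (sum_delta (fun i => V (y :: i :: s))).
by move=> i _; rewrite ev_top_cocycle !mxE.
Qed.

Lemma cocycle2_top_cocycle : cocycle2 top_cocycle.
Proof.
apply/cocycle2E => [x y|x y w s].
  by case/in_C2E: in_C_top_cocycle => /(_ x y)/gdeg_slE[].
rewrite !ev_top_cocycle (alternating_swap w x) // (alternating_swap w y) //.
rewrite (alternating_swap y x) // !scaleNr.
by apply/rowP => i; rewrite !mxE; ring.
Qed.

(** The first summand gives n copies of [V v] through the trace of the identity, the second gives
    one more. *)
Lemma trace_form_top_cocycle v : trace_form top_cocycle v = V v *+ n.+1.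
Proof.
case: v => [|x u]; first by rewrite supp_vol_top ?mul0rn.
rewrite /= /partial_trace (eq_bigr (fun i => V (x :: u) + V (i :: u) * (i == x)%:R)).
  by rewrite big_split /= sumr_const card_ord (sum_delta (fun i => V (i :: u))) addrC -mulrS.
by move=> i _; rewrite ev_top_cocycle !mxE !eqxx mulr1.
Qed.

Lemma trace_form_sub l (c d : Cochain m 2) v :
  trace_form (c - l *: d) v = trace_form c v - l * trace_form d v.
Proof.
case: v => [|x u] /=; first by rewrite mulr0 subr0.
rewrite /partial_trace mulr_sumr -sumrB; apply: eq_bigr => i _.
by rewrite 2!ffunE ffunE evD -scaleNr evZ mxE mxE mulNr.
Qed.

Lemma vol_enum : V (enum I) = 1.
Proof. by apply: vol_id; exact: enum_uniq. Qed.

Lemma top_cocycle_neq0 : top_cocycle <> 0.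
Proof.
move=> t0; have /eqP := trace_form_top_cocycle (enum I).
rewrite vol_enum t0 eq_sym => /idPn[]; case: (enum I) => [|x u].
  by rewrite pnatr_eq0.
rewrite /= /partial_trace big1 ?pnatr_eq0 // => i _.
by rewrite ffunE ev0 mxE.
Qed.

Lemma sl_top_multiple (z : Cochain m 2) : in_C (@sl_n F n) z -> cocycle2 z ->
  exists l : F, coboundary2 (@sl_n F n) (z - l *: top_cocycle).
Proof.
move=> zC zc.
(* This makes the trace form of the difference vanish at [enum I], hence everywhere, as it has top
   degree. *)
exists (trace_form z (enum I) / n.+1%:R).
have dC := in_C_sl_sub (trace_form z (enum I) / n.+1%:R) zC in_C_top_cocycle.
have dc := cocycle2_sub (trace_form z (enum I) / n.+1%:R) zc cocycle2_top_cocycle.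
apply: (sl_coboundary dC dc); right=> v.
have [vn|vn] := eqVneq (size v) n; last first.
  case: v vn => [|x u] //=; rewrite eqSS => um.
  by rewrite /partial_trace big1 // => i _; rewrite supp_ev ?mxE.
apply: (alternating_uniq_perm vn (size_enum_ord n) (enum_uniq _)).
  exact: alternating_trace_form.
rewrite trace_form_sub trace_form_top_cocycle vol_enum divfK ?subrr //.
by rewrite pnatr_eq0.
Qed.

Lemma leib_tuple (A : I -> I -> F) k (w : seq I -> F) (t : k.-tuple I) :
  \sum_(i < k) \sum_(b < n) A (tnth t i) b * w (replace t i b) = leib A w t.
Proof.
elim: k w t => [|k IHk] w t; first by rewrite big_ord0 (tuple0 t).
case/tupleP: t => a t; rewrite big_ord_recl /=; congr (_ + _).
  apply: eq_bigr => b _; rewrite tnth0; congr (_ * w _).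
  rewrite /replace /= enum_ordSl /=; congr (_ :: _).
  rewrite -map_comp -[RHS](map_tnth_enum t).
  by apply: eq_map => i /=; rewrite tnthS.
rewrite -IHk; apply: eq_bigr => i _; apply: eq_bigr => b _.
rewrite tnthS; congr (_ * w _).
rewrite /replace /= enum_ordSl /= tnth0; congr (_ :: _).
by rewrite -map_comp; apply: eq_map => j /=; rewrite tnthS.
Qed.

Lemma actU_mul (X : ML 1) v : actU X v = v *m \matrix_b X [tuple b].
Proof.
by rewrite mulmx_sum_row; apply: eq_bigr => b _; rewrite rowK.
Qed.

Lemma actUD (X : ML 1) v w : actU X (v + w) = actU X v + actU X w.
Proof. by rewrite !actU_mul mulmxDl. Qed.

Lemma actUZ (X : ML 1) a v : actU X (a *: v) = a *: actU X v.
Proof. by rewrite !actU_mul scalemxAl. Qed.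

Lemma actU_delta (X : ML 1) x : actU X (e x) = X [tuple x].
Proof. by rewrite actU_mul -rowE rowK. Qed.

(** The cocycle is built from the volume form, which traceless [X] kills, and the identity of U,
    which is invariant. [leibV] expresses the first fact by trading the action on [u] for that on
    [x]. *)
Lemma actC_top_cocycle (X : ML 1) : sl_n X -> actC X top_cocycle = 0.
Proof.
move=> /eqP X0; pose A (a b : I) : F := X [tuple a] 0 b.
apply/ffunP => t; apply/ffunP => u.
have leibV x : leib A (fun s => V (x :: s)) u = - \sum_(b < n) A x b * V (b :: u).
  apply/eqP; rewrite -addr_eq0 addrC; apply/eqP.
  by apply: (leib_top (v := x :: u) VA _ X0); rewrite /= size_tuple.
have XE x : X [tuple x] = \sum_(b < n) A x b *: e b by exact: row_sum_delta.
have topE s (v : m.-tuple I) : top_cocycle s v = V (tnth s ord0 :: v) *: e (tnth s ord_max)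
    + V (tnth s ord_max :: v) *: e (tnth s ord0) by rewrite !ffunE.
move tx: (tnth t ord0) => x; move ty: (tnth t ord_max) => y.
have sumE p (B : 'I_p -> I -> F) (f g : 'I_p -> I -> F) a b :
    \sum_(i < p) \sum_(c < n) B i c *: (f i c *: e a + g i c *: e b)
    = (\sum_(i < p) \sum_(c < n) B i c * f i c) *: e a
      + (\sum_(i < p) \sum_(c < n) B i c * g i c) *: e b.
  rewrite !scaler_suml -big_split; apply: eq_bigr => i _.
  rewrite !scaler_suml -big_split; apply: eq_bigr => c _.
  by rewrite scalerDr !scalerA.
have actMLE : actML X (top_cocycle t) u = V (x :: u) *: X [tuple y] + V (y :: u) *: X [tuple x]
    + (\sum_(b < n) A x b * V (b :: u)) *: e y
    + (\sum_(b < n) A y b * V (b :: u)) *: e x.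
  rewrite ffunE topE tx ty actUD !actUZ !actU_delta.
  under eq_bigr do under eq_bigr do rewrite topE tx ty.
  rewrite sumE (leib_tuple A (fun s => V (x :: s))) (leib_tuple A (fun s => V (y :: s))).
  by rewrite !leibV !scaleNr -opprD opprK addrA.
have argE : \sum_(i < 2) \sum_(b < n)
      (X [tuple tnth t i] 0 b *: top_cocycle (replace t i b)) u
    = V (x :: u) *: X [tuple y] + V (y :: u) *: X [tuple x]
    + (\sum_(b < n) A x b * V (b :: u)) *: e y
    + (\sum_(b < n) A y b * V (b :: u)) *: e x.
  rewrite big_ord_recl big_ord1 !scaler_suml.
  rewrite [in RHS](XE x) [in RHS](XE y) !scaler_sumr.
  rewrite (_ : lift _ _ = ord_max) ?tx ?ty; last exact: val_inj.
  rewrite -!big_split /=; apply: eq_bigr => b _.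
  rewrite ffunE topE [X in _ + X]ffunE topE !tnth_mktuple /= tx ty.
  rewrite -/(A x b) -/(A y b); apply/rowP => j; rewrite !mxE.
  by move: (A x b) (A y b) => ? ?; ring.
rewrite ffunE [LHS]ffunE actMLE [X in _ + X]ffunE sum_ffunE.
under [X in _ - X]eq_bigr do rewrite sum_ffunE.
by rewrite argE subrr ffunE ffunE.
Qed.

Lemma actCZ (X : ML 1) l (c : Cochain m 2) : actC X (l *: c) = l *: actC X c.
Proof.
apply/ffunP => t; apply/ffunP => u.
rewrite !ffunE !sum_ffunE actUZ !scalerBr !scaler_sumr.
congr (_ - _ - _); apply: eq_bigr => i _; rewrite ?sum_ffunE scaler_sumr.
  by apply: eq_bigr => b _; rewrite !ffunE !scalerA mulrC.
by apply: eq_bigr => b _; rewrite !ffunE !scalerA mulrC.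
Qed.

End TopDegree.

(* H^{k,2} indexed by k = m.+1 > 0; Cochain F n m 2 = C^{m+1,2}. *)
Theorem theorem2p1 (F : numClosedFieldType) (n : nat) :
  (1 < n)%N ->
  (* a) H^{k,2}_{gl(n)} = 0 for all k > 0 *)
  (forall m : nat, H2_vanishes (@gl_n F n) m) /\
  (* b) H^{k,2}_{sl(n)} = Pi^n(C) delta_{kn} *)
  ((forall m : nat, m.+1 <> n -> H2_vanishes (@sl_n F n) m) /\
   H2_trivial_1dim (@sl_n F n) n.-1 /\
   cochain_parity n.-1 2 = (n %% 2)%N).
Proof.
move=> n1; split; first by move=> m; exact: gl_H2_vanishes.
split; first by move=> m mn c cC cc; apply: sl_coboundary => //; left.
case: n n1 => // m _; split; last by rewrite /cochain_parity addn2 -modnDr addn2.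
split=> [|X z X0 zC zc].
  exists (top_cocycle F m); split=> [|||z].
  - exact: in_C_top_cocycle.
  - exact: cocycle2_top_cocycle.
  - by move/sl_coboundary_top; exact: top_cocycle_neq0.
  - exact: sl_top_multiple.
(* With no nonzero coboundaries in this degree, [z] equals [l *: top_cocycle] exactly. *)
have [l] := sl_top_multiple zC zc.
move=> /sl_coboundary_top/eqP; rewrite subr_eq0 => /eqP ->.
rewrite actCZ actC_top_cocycle // scaler0.
exists 0; split; last first.
  apply/ffunP => t; rewrite (tuple2_eta t) spencer_d1E.
  by apply: ev_inj => s; rewrite evD !ev_contract !ffunE !ev0 addr0.
apply/in_C1E => x; apply/gdeg_slE; split=> [s1 a b s2|s].
  by rewrite ffunE !ev0 oppr0.
by rewrite /dvg big1 // => i _; rewrite ffunE ev0 mxE.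
Qed.
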